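(* Consider the scenario-oriented energy-reserve co-optimization model (II) and the settlement quantities described in the context, evaluated at an optimal solution with associated optimal Lagrange multipliers. Assume $\sum_{k\in\mathcal K}\overline{\tau}_k^*(l)=0$ for every load $l$. Then, in expectation, total load payment (with load-shedding compensation counted) equals the sum of total generator credit and total congestion rent $\Delta=\Delta_0+\sum_{k\in\mathcal K}\Delta_k$, i.e. $$\mathbf 1^T\Big(\Gamma^d_0+\sum_{k\in\mathcal K}(\Gamma^d_k+\Gamma^\pi_k)\Big)=\mathbf 1^T\Big(\Gamma^g_0+\sum_{k\in\mathcal K}(\Gamma^g_k+\Gamma^U_k+\Gamma^D_k+\epsilon_k\Phi^U_k+\epsilon_k\Phi^D_k)\Big)+\mathbf 1^T\sum_{k\in\mathcal K}\epsilon_k\Phi^d_k+\Delta .$$ Moreover, this decomposes scenario-wise: for the base case $$\mathbf 1^T\Gamma^d_0=\mathbf 1^T\Gamma^g_0+\Delta_0,$$ and for each non-base scenario $k\in\mathcal K$ $$\mathbf 1^T(\Gamma^d_k+\Gamma^\pi_k)=\mathbf 1^T(\Gamma^g_k+\Gamma^U_k+\Gamma^D_k+\epsilon_k\Phi^U_k+\epsilon_k\Phi^D_k+\epsilon_k\Phi^d_k)+\Delta_k .$$ Here $\mathbf 1^T$ of a quantity indexed by generators (resp. loads) is its sum over all generators (resp. loads).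
   Context: Model (II). There are finitely many buses, generators $j$ (located at bus $m_j$), loads $l$ (located at bus $m_l$), and a finite set $\mathcal K$ of mutually exclusive non-base scenarios with given occurrence probabilities $\epsilon_k>0$, $\sum_{k\in\mathcal K}\epsilon_k\le 1$. The setting is single-period, lossless DC power flow; renewables are treated as negative loads; non-base scenarios may contain line outages and load fluctuations but no generator outages. Decision variables: generation $g$, upward reserve $r_U$, downward reserve $r_D$ (vectors over generators), and for each $k\in\mathcal K$ upward/downward re-dispatch $\delta g^U_k,\delta g^D_k$ (over generators) and load shedding $\delta d_k$ (over loads). Data: bid-in prices $c_g,c_U,c_D$, re-dispatch prices $\overline c,\underline c$, load-shedding prices $c_L$, base load $d$, load fluctuation $\pi_k$ (with $d+\pi_k\ge 0$), generation bounds $\underline G,\overline G$, reserve bounds $\overline{r_U},\overline{r_D}$, line limits $f$ (base) and $f_k$ (scenario $k$), shift-factor matrices $S_G,S_D$ (base) and $S_{G,k},S_{D,k}$ (scenario $k$) for generators and loads. Model (II) is the linear program $$\min\; F=c_g^Tg+c_U^Tr_U+c_D^Tr_D+\sum_{k\in\mathcal K}\epsilon_k(\overline c^T\delta g^U_k-\underline c^T\delta g^D_k+c_L^T\delta d_k)$$ subject to (multipliers in front) $(\lambda,\mu)$: $\mathbf 1^Tg=\mathbf 1^Td$, $S_Gg-S_Dd\le f$; $(\underline\upsilon,\overline\upsilon)$: $\underline G+r_D\le g$, $g+r_U\le\overline G$; $(\underline{\rho^U},\overline{\rho^U},\underline{\rho^D},\overline{\rho^D})$: $0\le r_U\le\overline{r_U}$,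 $0\le r_D\le\overline{r_D}$; and for all $k\in\mathcal K$: $\lambda_k$: $\mathbf 1^T(g+\delta g^U_k-\delta g^D_k)=\mathbf 1^T(d+\pi_k-\delta d_k)$; $\mu_k$: $S_{G,k}(g+\delta g^U_k-\delta g^D_k)-S_{D,k}(d+\pi_k-\delta d_k)\le f_k$; $(\underline{\alpha_k},\overline{\alpha_k})$: $0\le\delta g^U_k\le r_U$; $(\underline{\beta_k},\overline{\beta_k})$: $0\le\delta g^D_k\le r_D$; $(\underline{\tau_k},\overline{\tau_k})$: $0\le\delta d_k\le d+\pi_k$. Sign convention: the Lagrangian is $F$ plus $\lambda(\mathbf 1^Td-\mathbf 1^Tg)$, plus $\lambda_k(\mathbf 1^T(d+\pi_k-\delta d_k)-\mathbf 1^T(g+\delta g^U_k-\delta g^D_k))$ for each $k$, plus, for each inequality $a\le b$, its nonnegative multiplier times $(a-b)$. It is assumed that (II) has an optimal solution; superscript $*$ denotes optimal values and multipliers, fixed throughout; all primal quantities below are at the optimum. Shift factors depend only on the bus: $S_G(\cdot,m_j)$ denotes the column of $S_G$ for a generator at bus $m_j$, $S_D(\cdot,m_l)$ the column of $S_D$ for a load at bus $m_l$, and both are the column for that bus of a common bus shift-factor matrix (so $S_G(\cdot,m)=S_D(\cdot,m)$); likewise for $S_{G,k},S_{D,k}$. For a bus $m$, $\omega_0(m)=\lambda^*-S_G(\cdot,m)^T\mu^*$ and $\omega_k(m)=\lambda_k^*-S_{G,k}(\cdot,m)^T\mu_k^*$ (with $S_D,S_{D,k}$ giving the same values). Settlement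 quantities. Ex-ante: base-case generator energy credit $\Gamma^g_0(j)=\omega_0(m_j)g(j)$; scenario-$k$ contribution to generator energy credit $\Gamma^g_k(j)=\omega_k(m_j)g(j)$; base-case load energy payment $\Gamma^d_0(l)=\omega_0(m_l)d(l)$; scenario-$k$ contribution to load energy payment $\Gamma^d_k(l)=\omega_k(m_l)d(l)$; load fluctuation payment $\Gamma^\pi_k(l)=\omega_k(m_l)\pi_k(l)$; scenario-$k$ contributions to upward and downward reserve credits $\Gamma^U_k(j)=\overline{\alpha_k}^*(j)r_U(j)$, $\Gamma^D_k(j)=\overline{\beta_k}^*(j)r_D(j)$. Ex-post, if scenario $k$ is realized: upward re-dispatch credit $\Phi^U_k(j)=\overline c(j)\delta g^U_k(j)$; downward re-dispatch pay-back $\Phi^D_k(j)=-\underline c(j)\delta g^D_k(j)$; load shedding compensation $\Phi^d_k(l)=c_L(l)\delta d_k(l)$. If the base case is realized there is no ex-post settlement. Congestion rent: $\Delta_0=f^T\mu^*$, $\Delta_k=f_k^T\mu_k^*$, $\Delta=\Delta_0+\sum_{k\in\mathcal K}\Delta_k$. *)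

(* Defs.v *)
From HB Require Import structures.
From mathcomp Require Import all_boot all_order all_algebra.

Set Implicit Arguments.
Unset Strict Implicit.
Unset Printing Implicit Defensive.

Import Order.TTheory GRing.Theory Num.Theory.

#[local] Open Scope ring_scope.

(* Vectors indexed by a finite type T are functions T -> R. *)

Record model (R : realFieldType) := Model {
  bus : finType;
  gen : finType;
  load : finType;
  scen : finType;
  row : finType;                          (* line-limit constraints *)
  row_k : scen -> finType;                (* line outages may change them *)
  gbus : gen -> bus;
  lbus : load -> bus;
  eps : scen -> R;
  c_g : gen -> R;
  c_U : gen -> R;
  c_D : gen -> R;
  c_up : gen -> R;                        (* $\overline c$ *)
  c_dn : gen -> R;                        (* $\underline c$ *)
  c_L : load -> R;
  d : load -> R;
  pi_k : scen -> load -> R;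
  G_lo : gen -> R;
  G_hi : gen -> R;
  rU_max : gen -> R;
  rD_max : gen -> R;
  f : row -> R;
  f_k : forall k, row_k k -> R;
  SB : row -> bus -> R;                   (* bus shift factors *)
  SB_k : forall k, row_k k -> bus -> R
}.

Section Model.
Context {R : realFieldType} {M : model R}.

Record decision := Decision {
  g : gen M -> R;
  r_U : gen M -> R;
  r_D : gen M -> R;
  dgU : scen M -> gen M -> R;
  dgD : scen M -> gen M -> R;
  dd : scen M -> load M -> R              (* load shedding *)
}.

(* The suffixes _lo and _hi stand for the under- and overlined multipliers. *)
Record multipliers := Multipliers {
  lam : R;
  mu : row M -> R;
  ups_lo : gen M -> R;
  ups_hi : gen M -> R;
  rhoU_lo : gen M -> R;
  rhoU_hi : gen M -> R;
  rhoD_lo : gen M -> R;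
  rhoD_hi : gen M -> R;
  lam_k : scen M -> R;
  mu_k : forall k : scen M, row_k k -> R;
  alpha_lo : scen M -> gen M -> R;
  alpha_hi : scen M -> gen M -> R;
  beta_lo : scen M -> gen M -> R;
  beta_hi : scen M -> gen M -> R;
  tau_lo : scen M -> load M -> R;
  tau_hi : scen M -> load M -> R
}.

Implicit Types (x y : decision) (p : multipliers) (k : scen M) (b : bus M).

Definition S_G (i : row M) (j : gen M) : R := SB i (gbus j).
Definition S_D (i : row M) (l : load M) : R := SB i (lbus l).
Definition S_Gk k (i : row_k k) (j : gen M) : R := SB_k i (gbus j).
Definition S_Dk k (i : row_k k) (l : load M) : R := SB_k i (lbus l).

Definition objective x : R :=
  \sum_j c_g j * g x j + \sum_j c_U j * r_U x j + \sum_j c_D j * r_D x j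
  + \sum_k eps k * (\sum_j c_up j * dgU x k j - \sum_j c_dn j * dgD x k j
                    + \sum_l c_L l * dd x k l).

Definition gen_k x k (j : gen M) : R := g x j + dgU x k j - dgD x k j.
Definition load_k x k (l : load M) : R := d l + pi_k k l - dd x k l.

Definition flow x (i : row M) : R :=
  \sum_j S_G i j * g x j - \sum_l S_D i l * d l.
Definition flow_k x k (i : row_k k) : R :=
  \sum_j S_Gk i j * gen_k x k j - \sum_l S_Dk i l * load_k x k l.

Record feasible x : Prop := Feasible {
  base_balance : \sum_j g x j = \sum_l d (m := M) l;
  base_flow : forall i, flow x i <= f i;
  gen_lower : forall j, G_lo j + r_D x j <= g x j;
  gen_upper : forall j, g x j + r_U x j <= G_hi j;
  rU_bounds : forall j, 0 <= r_U x j <= rU_max j;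
  rD_bounds : forall j, 0 <= r_D x j <= rD_max j;
  scen_balance : forall k, \sum_j gen_k x k j = \sum_l load_k x k l;
  scen_flow : forall k (i : row_k k), flow_k x i <= f_k i;
  dgU_bounds : forall k j, 0 <= dgU x k j <= r_U x j;
  dgD_bounds : forall k j, 0 <= dgD x k j <= r_D x j;
  dd_bounds : forall k l, 0 <= dd x k l <= d l + pi_k k l
}.

Definition optimal x : Prop :=
  feasible x /\ forall y, feasible y -> objective x <= objective y.

Definition lagrangian x p : R :=
  objective x
  + lam p * (\sum_l d (m := M) l - \sum_j g x j)
  + \sum_i mu p i * (flow x i - f i)
  + \sum_j ups_lo p j * (G_lo j + r_D x j - g x j)
  + \sum_j ups_hi p j * (g x j + r_U x j - G_hi j)
  + \sum_j rhoU_lo p j * (0 - r_U x j)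
  + \sum_j rhoU_hi p j * (r_U x j - rU_max j)
  + \sum_j rhoD_lo p j * (0 - r_D x j)
  + \sum_j rhoD_hi p j * (r_D x j - rD_max j)
  + \sum_k (lam_k p k * (\sum_l load_k x k l - \sum_j gen_k x k j)
            + \sum_(i : row_k k) mu_k p i * (flow_k x i - f_k i)
            + \sum_j alpha_lo p k j * (0 - dgU x k j)
            + \sum_j alpha_hi p k j * (dgU x k j - r_U x j)
            + \sum_j beta_lo p k j * (0 - dgD x k j)
            + \sum_j beta_hi p k j * (dgD x k j - r_D x j)
            + \sum_l tau_lo p k l * (0 - dd x k l)
            + \sum_l tau_hi p k l * (dd x k l - (d l + pi_k k l))).

(* lam and lam_k belong to equality constraints and have free sign. *)
Record nonneg_multipliers p : Prop := NonnegMultipliers {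
  mu_ge0 : forall i, 0 <= mu p i;
  ups_lo_ge0 : forall j, 0 <= ups_lo p j;
  ups_hi_ge0 : forall j, 0 <= ups_hi p j;
  rhoU_lo_ge0 : forall j, 0 <= rhoU_lo p j;
  rhoU_hi_ge0 : forall j, 0 <= rhoU_hi p j;
  rhoD_lo_ge0 : forall j, 0 <= rhoD_lo p j;
  rhoD_hi_ge0 : forall j, 0 <= rhoD_hi p j;
  mu_k_ge0 : forall k (i : row_k k), 0 <= mu_k p i;
  alpha_lo_ge0 : forall k j, 0 <= alpha_lo p k j;
  alpha_hi_ge0 : forall k j, 0 <= alpha_hi p k j;
  beta_lo_ge0 : forall k j, 0 <= beta_lo p k j;
  beta_hi_ge0 : forall k j, 0 <= beta_hi p k j;
  tau_lo_ge0 : forall k l, 0 <= tau_lo p k l;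
  tau_hi_ge0 : forall k l, 0 <= tau_hi p k l
}.

(* For x optimal: the infimum of the Lagrangian over all (unconstrained)
   decisions equals the optimal value. Only >= is required, since
   lagrangian x p <= objective x for feasible x and nonnegative p. *)
Definition optimal_multipliers x p : Prop :=
  nonneg_multipliers p /\ forall y, objective x <= lagrangian y p.

Definition omega_0 p b : R := lam p - \sum_i SB i b * mu p i.
Definition omega_k p k b : R :=
  lam_k p k - \sum_(i : row_k k) SB_k i b * mu_k p i.

Definition Gamma_g0 x p (j : gen M) : R := omega_0 p (gbus j) * g x j.
Definition Gamma_gk x p k (j : gen M) : R := omega_k p k (gbus j) * g x j.
Definition Gamma_d0 p (l : load M) : R := omega_0 p (lbus l) * d l.
Definition Gamma_dk p k (l : load M) : R := omega_k p k (lbus l) * d l.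
Definition Gamma_pik p k (l : load M) : R := omega_k p k (lbus l) * pi_k k l.
Definition Gamma_Uk x p k (j : gen M) : R := alpha_hi p k j * r_U x j.
Definition Gamma_Dk x p k (j : gen M) : R := beta_hi p k j * r_D x j.

Definition Phi_Uk x k (j : gen M) : R := c_up j * dgU x k j.
Definition Phi_Dk x k (j : gen M) : R := - c_dn j * dgD x k j.
Definition Phi_dk x k (l : load M) : R := c_L l * dd x k l.

Definition Delta_0 p : R := \sum_i f i * mu p i.
Definition Delta_k p k : R := \sum_(i : row_k k) f_k i * mu_k p i.
Definition Delta p : R := Delta_0 p + \sum_k Delta_k p k.

End Model.

Arguments decision {R} M.
Arguments multipliers {R} M.

(* Main.v *)
Require Import Defs.
From mathcomp Require Import all_boot all_order all_algebra.
From mathcomp Require Import ring lra.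

(** Strong duality makes the optimum [x] a minimizer of the Lagrangian with all
    penalty terms equal to zero.  The base-case identity is the balance equation
    combined with the vanishing of the [mu] term.  For scenario [k], the
    Lagrangian is affine along the line scaling the recourse of [k] by [t], so,
    being minimal at [t = 1], it takes the same value at [t = 0]; this equality
    of values is exactly the scenario-[k] settlement identity. *)

Import Order.TTheory GRing.Theory Num.Theory.
Local Open Scope ring_scope.

Set Implicit Arguments.
Unset Strict Implicit.
Unset Printing Implicit Defensive.

Section Settlement.
Context {R : realFieldType} {M : model R}.
Implicit Types (x y : decision M) (p : multipliers M) (k : scen M).

(** * Penalty terms of the Lagrangian and complementary slackness *)

Definition redispatch_cost y k : R :=
  \sum_j c_up j * dgU y k j - \sum_j c_dn j * dgD y k j
  + \sum_l c_L l * dd y k l.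

Definition base_penalty y p : R :=
  lam p * (\sum_l d (m := M) l - \sum_j g y j)
  + \sum_i mu p i * (flow y i - f i)
  + \sum_j ups_lo p j * (G_lo j + r_D y j - g y j)
  + \sum_j ups_hi p j * (g y j + r_U y j - G_hi j)
  + \sum_j rhoU_lo p j * (0 - r_U y j)
  + \sum_j rhoU_hi p j * (r_U y j - rU_max j)
  + \sum_j rhoD_lo p j * (0 - r_D y j)
  + \sum_j rhoD_hi p j * (r_D y j - rD_max j).

Definition scen_penalty y p k : R :=
  lam_k p k * (\sum_l load_k y k l - \sum_j gen_k y k j)
  + \sum_(i : row_k k) mu_k p i * (flow_k y i - f_k i)
  + \sum_j alpha_lo p k j * (0 - dgU y k j)
  + \sum_j alpha_hi p k j * (dgU y k j - r_U y j)
  + \sum_j beta_lo p k j * (0 - dgD y k j)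
  + \sum_j beta_hi p k j * (dgD y k j - r_D y j)
  + \sum_l tau_lo p k l * (0 - dd y k l)
  + \sum_l tau_hi p k l * (dd y k l - (d l + pi_k k l)).

Lemma lagrangianE y p :
  lagrangian y p = objective y + base_penalty y p + \sum_k scen_penalty y p k.
Proof. by rewrite /lagrangian /base_penalty !addrA. Qed.

Lemma sum_penalty_le0 (I : finType) (m a : I -> R) :
  (forall i, 0 <= m i) -> (forall i, a i <= 0) -> \sum_i m i * a i <= 0.
Proof. by move=> m0 a0; apply: sumr_le0 => i _; rewrite mulr_ge0_le0. Qed.

Lemma addr_le0 (a b : R) : a <= 0 -> b <= 0 -> a + b <= 0.
Proof. by move=> a0 b0; rewrite -[0]addr0 lerD. Qed.

(** Balance removes the [lam] term, and the other discarded terms pair nonnegative multipliers with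
    nonpositive slacks. The [mu] term stays on the right so that its own vanishing can be extracted
    later. *)
Lemma base_penalty_le x p : feasible x -> nonneg_multipliers p ->
  base_penalty x p <= \sum_i mu p i * (flow x i - f i).
Proof.
move=> fx np; rewrite /base_penalty (base_balance fx) subrr mulr0 add0r.
rewrite -!addrA gerDl.
do !apply: addr_le0; apply: sum_penalty_le0 => [|j].
- exact: ups_lo_ge0 np.
- by rewrite subr_le0; apply: gen_lower fx j.
- exact: ups_hi_ge0 np.
- by rewrite subr_le0; apply: gen_upper fx j.
- exact: rhoU_lo_ge0 np.
- by rewrite subr_le0; case/andP: (rU_bounds fx j).
- exact: rhoU_hi_ge0 np.
- by rewrite subr_le0; case/andP: (rU_bounds fx j).
- exact: rhoD_lo_ge0 np.
- by rewrite subr_le0; case/andP: (rD_bounds fx j).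
- exact: rhoD_hi_ge0 np.
- by rewrite subr_le0; case/andP: (rD_bounds fx j).
Qed.

Lemma flow_penalty_le0 x p : feasible x -> nonneg_multipliers p ->
  \sum_i mu p i * (flow x i - f i) <= 0.
Proof.
move=> fx np; apply: sum_penalty_le0 => i; first exact: mu_ge0 np i.
by rewrite subr_le0; apply: base_flow fx i.
Qed.

Lemma scen_penalty_le0 x p k : feasible x -> nonneg_multipliers p ->
  scen_penalty x p k <= 0.
Proof.
move=> fx np; rewrite /scen_penalty (scen_balance fx) subrr mulr0 add0r.
do !apply: addr_le0; apply: sum_penalty_le0 => [|j].
- exact: mu_k_ge0 np k.
- by rewrite subr_le0; apply: scen_flow fx k j.
- exact: alpha_lo_ge0 np k.
- by rewrite subr_le0; case/andP: (dgU_bounds fx k j).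
- exact: alpha_hi_ge0 np k.
- by rewrite subr_le0; case/andP: (dgU_bounds fx k j).
- exact: beta_lo_ge0 np k.
- by rewrite subr_le0; case/andP: (dgD_bounds fx k j).
- exact: beta_hi_ge0 np k.
- by rewrite subr_le0; case/andP: (dgD_bounds fx k j).
- exact: tau_lo_ge0 np k.
- by rewrite subr_le0; case/andP: (dd_bounds fx k j).
- exact: tau_hi_ge0 np k.
- by rewrite subr_le0; case/andP: (dd_bounds fx k j).
Qed.

Lemma complementary_slackness x p : feasible x -> optimal_multipliers x p ->
  [/\ \sum_i mu p i * (flow x i - f i) = 0,
      forall k, scen_penalty x p k = 0
    & lagrangian x p = objective x].
Proof.
move=> fx [np optp].
have sle0 : \sum_k scen_penalty x p k <= 0.
  by apply: sumr_le0 => k _; apply: scen_penalty_le0.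
have := optp x; rewrite lagrangianE.
have ble := base_penalty_le fx np; have mle0 := flow_penalty_le0 fx np.
(* [Lge] makes the total penalty nonnegative, while its base and scenario parts are each
   nonpositive; so both vanish, and the [mu] term is squeezed between the base part and 0. *)
move=> Lge; have s0 : \sum_k scen_penalty x p k = 0 by lra.
split; [lra | | lra].
move=> k; apply/eqP; rewrite -oppr_eq0.
have /psumr_eq0P s0P : forall k', true -> 0 <= - scen_penalty x p k'.
  by move=> k' _; rewrite oppr_ge0 scen_penalty_le0.
by apply/eqP/s0P => //; rewrite sumrN s0 oppr0.
Qed.

(** * Scaling the recourse of a single scenario *)

Definition scale_recourse (t : R) k x : decision M :=
  Decision (g x) (r_U x) (r_D x)
    (fun k' => if k' == k then fun j => t * dgU x k j else dgU x k')
    (fun k' => if k' == k then fun j => t * dgD x k j else dgD x k')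
    (fun k' => if k' == k then fun l => t * dd x k l else dd x k').

Definition scen_lagrangian y p k : R :=
  eps k * redispatch_cost y k + scen_penalty y p k.

Lemma lagrangian_scale_recourse t k x p :
  lagrangian (scale_recourse t k x) p - lagrangian x p
  = scen_lagrangian (scale_recourse t k x) p k - scen_lagrangian x p k.
Proof.
have LE y : lagrangian y p = \sum_j c_g j * g y j + \sum_j c_U j * r_U y j
    + \sum_j c_D j * r_D y j + base_penalty y p + \sum_k scen_lagrangian y p k.
  have -> : \sum_k scen_lagrangian y p k
      = \sum_k eps k * redispatch_cost y k + \sum_k scen_penalty y p k.
    by rewrite -big_split.
  by rewrite lagrangianE [RHS]addrA; congr (_ + _); rewrite [RHS]addrAC.
rewrite !LE (bigD1 k) //= [in X in _ - X](bigD1 k) //=.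
rewrite (eq_bigr (scen_lagrangian x p)); last first.
  move=> k' /negPf nk; rewrite /scen_lagrangian /redispatch_cost /scen_penalty.
  by rewrite /flow_k /load_k /gen_k /= nk.
(* Scaling leaves [g], [r_U] and [r_D] untouched, so the two base penalties are convertible. *)
rewrite [base_penalty (scale_recourse t k x) p]/base_penalty -/(base_penalty x p).
by ring.
Qed.

(* The triple [(a, b, c)] stands for the values of an affine function at the
   scaling factors [0], [2] and [1]. *)
Definition midpoint (a b c : R) := a + b = c + c.

Lemma midpoint_cst c : midpoint c c c.
Proof. by []. Qed.

Lemma midpointD a b c a' b' c' : midpoint a b c -> midpoint a' b' c' ->
  midpoint (a + a') (b + b') (c + c').
Proof. by rewrite /midpoint => h h'; lra. Qed.

Lemma midpointN a b c : midpoint a b c -> midpoint (- a) (- b) (- c).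
Proof. by rewrite /midpoint => h; lra. Qed.

Lemma midpointM s a b c : midpoint a b c -> midpoint (s * a) (s * b) (s * c).
Proof. by rewrite /midpoint -!mulrDr => ->. Qed.

Lemma midpoint_scale a : midpoint (0 * a) (2 * a) a.
Proof. by rewrite /midpoint; ring. Qed.

Lemma midpoint_sum (I : finType) (a b c : I -> R) :
  (forall i, midpoint (a i) (b i) (c i)) ->
  midpoint (\sum_i a i) (\sum_i b i) (\sum_i c i).
Proof.
move=> h; rewrite /midpoint -!big_split; apply: eq_bigr => i _; exact: h.
Qed.

(** Each summand is affine in the recourse of [k], and 1 is the midpoint of 0 and 2; the closure
    rules for [midpoint] follow the syntax of the expression. *)
Lemma scen_lagrangian_midpoint k x p :
  midpoint (scen_lagrangian (scale_recourse 0 k x) p k)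
           (scen_lagrangian (scale_recourse 2 k x) p k)
           (scen_lagrangian x p k).
Proof.
rewrite /scen_lagrangian /redispatch_cost /scen_penalty /flow_k /load_k /gen_k.
rewrite /= eqxx.
by do ![exact: midpoint_scale | exact: midpoint_cst | apply: midpointD
       | apply: midpointN | apply: midpointM | apply: midpoint_sum => ?].
Qed.

(** The Lagrangian values at factors 0 and 2 are both at least the value at 1 and average to it, so
    all three agree. At 0 only the penalty of [k] survives, at 1 only its expected cost. *)
Lemma scen_penalty_no_recourse k x p :
  feasible x -> optimal_multipliers x p ->
  scen_penalty (scale_recourse 0 k x) p k = eps k * redispatch_cost x k.
Proof.
move=> fx hp; have [_ /(_ k) s0 Lx] := complementary_slackness fx hp.
have L0 := lagrangian_scale_recourse 0 k x p.
have L2 := lagrangian_scale_recourse 2 k x p.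
have := scen_lagrangian_midpoint k x p; rewrite /midpoint.
(* The scaled decisions may be infeasible, but [hp] bounds the Lagrangian below over all
   decisions. *)
have := hp.2 (scale_recourse 0 k x); have := hp.2 (scale_recourse 2 k x).
have cost0 : redispatch_cost (scale_recourse 0 k x) k = 0.
  rewrite /redispatch_cost /= eqxx !big1 ?subr0 ?addr0 // => i _;
    by rewrite mul0r mulr0.
move: L0 L2; rewrite {2 4}/scen_lagrangian s0 /scen_lagrangian cost0 !mulr0.
by lra.
Qed.

(** * Nodal prices and the settlement identities *)

Lemma sum_mul_exchange (I J : finType) (m : I -> R) (S : I -> J -> R)
    (v : J -> R) :
  \sum_j (\sum_i S i j * m i) * v j = \sum_i m i * \sum_j S i j * v j.
Proof.
under eq_bigr do rewrite mulr_suml.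
rewrite exchange_big; apply: eq_bigr => i _; rewrite mulr_sumr.
by apply: eq_bigr => j _; ring.
Qed.

(** Serves [omega_0] and [omega_k] alike, with [h] being [gbus] or [lbus]: a total valued at nodal
    prices splits into an energy part and a congestion part. *)
Lemma nodal_value (B I J : finType) (c : R) (m : I -> R) (S : I -> B -> R)
    (h : J -> B) (v : J -> R) :
  \sum_j (c - \sum_i S i (h j) * m i) * v j
  = c * (\sum_j v j) - \sum_i m i * \sum_j S i (h j) * v j.
Proof.
under eq_bigr do rewrite mulrBl.
by rewrite sumrB -mulr_sumr (sum_mul_exchange m (fun i j => S i (h j))).
Qed.

Lemma base_settlement x p : feasible x -> optimal_multipliers x p ->
  \sum_(l : load M) Gamma_d0 p l
  = \sum_(j : gen M) Gamma_g0 x p j + Delta_0 p.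
Proof.
move=> fx hp; have [m0 _ _] := complementary_slackness fx hp.
rewrite /Gamma_d0 /Gamma_g0 /omega_0 !nodal_value (base_balance fx).
(* Slackness lets the actual flow replace the limit [f] in the congestion rent. *)
have -> : Delta_0 p = \sum_i mu p i * (\sum_j S_G i j * g x j)
                    - \sum_i mu p i * (\sum_l S_D i l * d l).
  move/eqP: m0; under eq_bigr do rewrite mulrBr.
  rewrite sumrB subr_eq0 -sumrB => /eqP mE.
  by rewrite /Delta_0; under eq_bigr do rewrite mulrC; rewrite -mE;
    apply: eq_bigr => i _; rewrite -mulrBr.
by rewrite /S_G /S_D; ring.
Qed.

(** Nonnegative multipliers cannot cancel across scenarios. *)
Lemma tau_hi_eq0 p : nonneg_multipliers p ->
  (forall l, \sum_k tau_hi p k l = 0) -> forall k l, tau_hi p k l = 0.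
Proof.
move=> np t0 k l.
have /psumr_eq0P tP : forall k', true -> 0 <= tau_hi p k' l.
  by move=> k' _; apply: tau_hi_ge0 np k' l.
exact: (tP (t0 l)).
Qed.

Lemma scen_settlement x p k : feasible x -> optimal_multipliers x p ->
  (forall l, tau_hi p k l = 0) ->
  \sum_(l : load M) (Gamma_dk p k l + Gamma_pik p k l)
  = \sum_(j : gen M)
      (Gamma_gk x p k j + Gamma_Uk x p k j + Gamma_Dk x p k j
       + eps k * Phi_Uk x k j + eps k * Phi_Dk x k j)
    + \sum_(l : load M) eps k * Phi_dk x k l
    + Delta_k p k.
Proof.
move=> fx hp t0; have := scen_penalty_no_recourse k fx hp.
rewrite /scen_penalty /flow_k /load_k /gen_k /= eqxx.
under eq_bigr do rewrite mul0r subr0.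
under [in X in _ - X]eq_bigr do rewrite !mul0r addr0 subr0.
(* With zero recourse the flow penalty yields the congestion parts of the generator and load values,
   and the rent. *)
have -> : \sum_(i : row_k k) mu_k p i
    * (\sum_j S_Gk i j * (g x j + 0 * dgU x k j - 0 * dgD x k j)
       - \sum_l S_Dk i l * (d l + pi_k k l - 0 * dd x k l) - f_k i)
  = \sum_(i : row_k k) mu_k p i * (\sum_j S_Gk i j * g x j)
    - \sum_(i : row_k k) mu_k p i * (\sum_l S_Dk i l * (d l + pi_k k l))
    - Delta_k p k.
  rewrite /Delta_k -!sumrB; apply: eq_bigr => i _.
  rewrite [f_k i * _]mulrC -!mulrBr.
  congr (_ * (_ - _ - _)); apply: eq_bigr => j _; congr (_ * _).
    by rewrite !mul0r addr0 subr0.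
  by rewrite mul0r subr0.
rewrite [\sum_j alpha_lo p k j * _]big1; last by move=> j _; ring.
rewrite [\sum_j beta_lo p k j * _]big1; last by move=> j _; ring.
rewrite [\sum_l tau_lo p k l * _]big1; last by move=> l _; ring.
(* Unlike the lower-bound terms above, this one keeps the slack [- (d l + pi_k k l)] at zero
   recourse; it disappears only through [t0]. *)
rewrite [\sum_l tau_hi p k l * _]big1; last by move=> l _; rewrite t0 mul0r.
have -> : \sum_j alpha_hi p k j * (0 * dgU x k j - r_U x j)
        = - \sum_j Gamma_Uk x p k j.
  by rewrite -sumrN; apply: eq_bigr => j _; rewrite /Gamma_Uk; ring.
have -> : \sum_j beta_hi p k j * (0 * dgD x k j - r_D x j)
        = - \sum_j Gamma_Dk x p k j.
  by rewrite -sumrN; apply: eq_bigr => j _; rewrite /Gamma_Dk; ring.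
have -> : \sum_l (Gamma_dk p k l + Gamma_pik p k l)
        = \sum_l omega_k p k (lbus l) * (d l + pi_k k l).
  by apply: eq_bigr => l _; rewrite -mulrDr.
rewrite !nodal_value !big_split /= -!mulr_sumr nodal_value.
have -> : \sum_j Phi_Dk x k j = - \sum_j c_dn j * dgD x k j.
  by rewrite -sumrN; apply: eq_bigr => j _; rewrite /Phi_Dk mulNr.
rewrite /redispatch_cost /Phi_Uk /Phi_dk /S_Gk /S_Dk.
by move=> h; lra.
Qed.

End Settlement.

Theorem theorem4 (R : realFieldType) (M : model R)
    (heps : forall k : scen M, 0 < eps k)
    (heps1 : \sum_(k : scen M) eps k <= 1)
    (hload : forall (k : scen M) (l : load M), 0 <= d l + pi_k k l)
    (x : decision M) (p : multipliers M)
    (hx : optimal x) (hp : optimal_multipliers x p)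
    (htau : forall l : load M, \sum_(k : scen M) tau_hi p k l = 0) :
  [/\ \sum_(l : load M)
        (Gamma_d0 p l + \sum_(k : scen M) (Gamma_dk p k l + Gamma_pik p k l))
      = \sum_(j : gen M)
          (Gamma_g0 x p j
           + \sum_(k : scen M)
               (Gamma_gk x p k j + Gamma_Uk x p k j + Gamma_Dk x p k j
                + eps k * Phi_Uk x k j + eps k * Phi_Dk x k j))
        + \sum_(l : load M) \sum_(k : scen M) eps k * Phi_dk x k l
        + Delta p,
      \sum_(l : load M) Gamma_d0 p l
      = \sum_(j : gen M) Gamma_g0 x p j + Delta_0 p
    & forall k : scen M,
      \sum_(l : load M) (Gamma_dk p k l + Gamma_pik p k l)
      = \sum_(j : gen M)
          (Gamma_gk x p k j + Gamma_Uk x p k j + Gamma_Dk x p k j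
           + eps k * Phi_Uk x k j + eps k * Phi_Dk x k j)
        + \sum_(l : load M) eps k * Phi_dk x k l
        + Delta_k p k].
Proof.
have fx := hx.1; have t0 := tau_hi_eq0 hp.1 htau.
have base := base_settlement fx hp.
have scen k := scen_settlement fx hp (t0 k).
split=> //.
(* The total identity is the base identity plus the sum of the scenario ones, once scenario sums are
   moved outside. *)
rewrite big_split /= base exchange_big /=.
rewrite (eq_bigr _ (fun k _ => scen k)) !big_split /= /Delta.
rewrite [\sum_l \sum_k eps k * _]exchange_big.
by rewrite [\sum_j \sum_k _]exchange_big /=; ring.
Qed.
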